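(* Let $S$ be a regular semigroup and $E=E(S)$ its biordered set of idempotents. Let $\phi: IG(E)\to RIG(E)$ be the natural homomorphism that is the identity on the generators $E$. Then $\phi$ restricts to a bijection from the set of regular elements of $IG(E)$ onto $RIG(E)$: for every $r\in RIG(E)$ there is a unique regular element $s\in IG(E)$ with $\phi(s)=r$. In particular, for every $e\in E$, $\phi$ restricts to an isomorphism from the maximal subgroup of $IG(E)$ containing $e$ onto the maximal subgroup of $RIG(E)$ containing $e$.
   Context: For idempotents $e,f$: $e\,\mathcal R\,f$ iff $ef=f,\ fe=e$; $e\,\mathcal L\,f$ iff $ef=e,\ fe=f$; $e\,\omega^r f$ iff $fe=e$; $e\,\omega^l f$ iff $ef=e$. A product $ef$ ($e,f\in E$) is basic if $e\,\omega^r f$, $e\,\omega^l f$, $f\,\omega^r e$ or $f\,\omega^l e$; then $ef\in E$. The biordered set of $S$ is $E$ with the partial multiplication given by basic products. The sandwich set of $e,f\in E$ is $S(e,f)=\{h\in E: ehf=ef,\ fhe=h\}$. The free idempotent generated semigroup is $IG(E)=\langle E\mid e^2=e\ (e\in E);\ e\cdot f=ef \text{ whenever } ef \text{ is a basic product}\rangle$, and the free regular idempotent generated semigroup is $RIG(E)$, given by the same presentation with the additional relations $ef=ehf$ for all $e,f\in E$ and $h\in S(e,f)$. (It is known that $E$ is exactly the set of idempotents of both $IG(E)$ and $RIG(E)$, with the same biordered structure, and that $RIG(E)$ is regular.) The maximal subgroup containing an idempotent $e$ is the group of units of the monoid $eTe$ for $T=IG(E)$ or $RIG(E)$. *)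

(* Defs.v *)
(* Semigroups are given by a carrier S and an associative
   multiplication mul.  IG(E) and RIG(E) are presented as quotients of the
   free semigroup on E (nonempty words of idempotents of S, product =
   concatenation) by congruences generated by the defining relations. *)
From Stdlib Require Import List.
Import ListNotations.
Set Implicit Arguments.

Section Defs.
Variable S : Type.
Variable mul : S -> S -> S.

Definition idem (e : S) : Prop := mul e e = e.

Definition omega_r (e f : S) : Prop := mul f e = e.
Definition omega_l (e f : S) : Prop := mul e f = e.

Definition basic (e f : S) : Prop :=
  omega_r e f \/ omega_l e f \/ omega_r f e \/ omega_l f e.

Definition sandwich (e f h : S) : Prop :=
  idem h /\ mul (mul e h) f = mul e f /\ mul (mul f h) e = h.

Definition wf (w : list S) : Prop := w <> [] /\ Forall idem w.

Inductive IGrel : list S -> list S -> Prop :=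
| IG_idem e : idem e -> IGrel [e; e] [e]
| IG_basic e f : idem e -> idem f -> basic e f -> IGrel [e; f] [mul e f].

Inductive RIGrel : list S -> list S -> Prop :=
| RIG_IG l r : IGrel l r -> RIGrel l r
| RIG_sandwich e f h : idem e -> idem f -> sandwich e f h ->
    RIGrel [e; f] [e; h; f].

Inductive cong (R : list S -> list S -> Prop) : list S -> list S -> Prop :=
| cong_step u v l r : R l r -> cong R (u ++ l ++ v) (u ++ r ++ v)
| cong_refl w : cong R w w
| cong_sym w1 w2 : cong R w1 w2 -> cong R w2 w1
| cong_trans w1 w2 w3 : cong R w1 w2 -> cong R w2 w3 -> cong R w1 w3.

Definition IGeq := cong IGrel.
Definition RIGeq := cong RIGrel.

Definition regular_in (R : list S -> list S -> Prop) (w : list S) : Prop :=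
  exists x, wf x /\ cong R (w ++ x ++ w) w.

(* w represents an element of the maximal subgroup containing e,
   i.e. a unit of the monoid eTe (identity e) *)
Definition in_maxsub (R : list S -> list S -> Prop) (e : S) (w : list S) : Prop :=
  wf w /\ cong R w ([e] ++ w ++ [e]) /\
  exists v, wf v /\ cong R v ([e] ++ v ++ [e]) /\
            cong R (w ++ v) [e] /\ cong R (v ++ w) [e].
End Defs.

(* Main.v *)
(** Write [T = IG(E)].

    If [u] in [T] is L-related to a member of [E] and [u e f] is R-related to
    [u], then some [k] in [E] satisfies [u e k = u e], [f k = k] and [k e = k];
    for [h] in the sandwich set of [(e, f)] the product [(kf)(hf) = kf] is
    basic, whence [u e h f = u e k h f = u e k f = u e f] in [T].  Thus [RIG(E)]
    acts by partial maps on such R-classes of [T], and dually on L-classes;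
    letting two regular elements with the same image act on idempotents shows
    that they coincide.  Surjectivity holds because [s e = s g e = s g h e] in
    [RIG(E)], where [g] is an idempotent in the L-class of [s] and [h] is in
    the sandwich set of [(g, e)], and [s g h e] is regular in [T].

    It remains to see that each regular element of [T] is L- and R-related to
    members of [E].  A seed of a word is a letter [s], [w = u s v], such that
    [u s] is L-related and [s v] R-related to [s] in [S]; these relations lift
    to [T].  The least number of seeded words into which a word factors is an
    invariant of its class in [T].  Comparing [p p] with [p] for an idempotent
    [p] of [T] forces this number to be 1, and from idempotents seeds are
    passed on to all regular elements. *)
Require Import Defs.
From Stdlib Require Import List Arith Lia Setoid Morphisms.
Import ListNotations.

(** * Congruences on words and concatenation *)

Section Congruence.
Variables (A : Type) (R : list A -> list A -> Prop).

#[export] Instance cong_equivalence : Equivalence (cong R).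
Proof.
  split; red; intros.
  - apply cong_refl.
  - now apply cong_sym.
  - eapply cong_trans; eassumption.
Qed.

Lemma cong_ctx u v w w' : cong R w w' -> cong R (u ++ w ++ v) (u ++ w' ++ v).
Proof.
  induction 1 as [a b l r H| | |].
  - generalize (cong_step R (u ++ a) (b ++ v) _ _ H). now rewrite <- !app_assoc.
  - reflexivity.
  - now symmetry.
  - etransitivity; eassumption.
Qed.

#[export] Instance app_cong_proper :
  Proper (cong R ==> cong R ==> cong R) (@app A).
Proof.
  intros u u' Hu v v' Hv. transitivity (u ++ v').
  - generalize (cong_ctx u [] _ _ Hv). now rewrite !app_nil_r.
  - exact (cong_ctx [] v' _ _ Hu).
Qed.

#[export] Instance cons_cong_proper :
  Proper (eq ==> cong R ==> cong R) (@cons A).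
Proof.
  intros x x' <- v v' Hv. change (cong R ([x] ++ v) ([x] ++ v')). now rewrite Hv.
Qed.

Lemma cong_head u v : cong R u v -> forall w, cong R (u ++ w) (v ++ w).
Proof. intros H w. now rewrite H. Qed.

Lemma cong_local_unit e s : cong R [e; e] [e] -> cong R s ([e] ++ s ++ [e]) ->
  cong R (e :: s) s /\ cong R (s ++ [e]) s.
Proof.
  intros He Hs. split.
  - transitivity ([e] ++ [e] ++ s ++ [e]); [now rewrite <- Hs|].
    rewrite app_assoc. simpl. change (e :: e :: s ++ [e]) with ([e; e] ++ s ++ [e]).
    now rewrite He, <- Hs.
  - transitivity (([e] ++ s ++ [e]) ++ [e]); [now rewrite <- Hs|].
    rewrite <- !app_assoc. simpl app at 3. now rewrite He, <- Hs.
Qed.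
End Congruence.

#[export] Instance IGeq_equivalence (A : Type) (mul : A -> A -> A) :
  Equivalence (IGeq mul) := cong_equivalence _ _.

#[export] Instance IGeq_app (A : Type) (mul : A -> A -> A) :
  Proper (IGeq mul ==> IGeq mul ==> IGeq mul) (@app A) := app_cong_proper _ _.

#[export] Instance IGeq_cons (A : Type) (mul : A -> A -> A) :
  Proper (eq ==> IGeq mul ==> IGeq mul) (@cons A) := cons_cong_proper _ _.

Lemma cong_mono (A : Type) (R R' : list A -> list A -> Prop) :
  (forall l r, R l r -> cong R' l r) ->
  forall u v, cong R u v -> cong R' u v.
Proof.
  intros HR u v. induction 1 as [a b l r H| | |].
  - now apply cong_ctx, HR.
  - reflexivity.
  - now symmetry.
  - etransitivity; eassumption.
Qed.

Lemma IGeq_RIGeq (A : Type) (mul : A -> A -> A) u v :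
  IGeq mul u v -> RIGeq mul u v.
Proof.
  apply cong_mono. intros l r H.
  generalize (cong_step (RIGrel mul) [] [] _ _ (RIG_IG H)). now rewrite !app_nil_r.
Qed.

(** * Duality *)

Definition op {A : Type} (mul : A -> A -> A) (a b : A) : A := mul b a.

Lemma cong_rev (A : Type) (R R' : list A -> list A -> Prop) :
  (forall l r, R l r -> R' (rev l) (rev r)) ->
  forall u v, cong R u v -> cong R' (rev u) (rev v).
Proof.
  intros HR u v. induction 1 as [a b l r H| | |].
  - rewrite !rev_app_distr, <- !app_assoc. now apply cong_step, HR.
  - reflexivity.
  - now symmetry.
  - etransitivity; eassumption.
Qed.

(** Reversal exchanges [omega_r] and [omega_l], so it permutes the four kinds of basic product. *)
Lemma IGrel_op (A : Type) (mul : A -> A -> A) l r :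
  IGrel mul l r -> IGrel (op mul) (rev l) (rev r).
Proof.
  intros [e He|e f He Hf Hb]; simpl.
  - now apply IG_idem.
  - apply (IG_basic (mul := op mul)); trivial.
    unfold basic, omega_r, omega_l, op in *. tauto.
Qed.

Lemma IGeq_op (A : Type) (mul : A -> A -> A) u v :
  IGeq mul u v -> IGeq (op mul) (rev u) (rev v).
Proof. apply cong_rev, IGrel_op. Qed.

(** The sandwich set of [e], [f] is the sandwich set of [f], [e] for the opposite product. *)
Lemma RIGeq_op (A : Type) (mul : A -> A -> A) :
  (forall a b c, mul a (mul b c) = mul (mul a b) c) ->
  forall u v, RIGeq mul u v -> RIGeq (op mul) (rev u) (rev v).
Proof.
  intros assoc. apply cong_rev. intros _ _ [l r H|e f h He Hf [Hh [H1 H2]]].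
  - now apply RIG_IG, IGrel_op.
  - simpl. apply RIG_sandwich; trivial. unfold sandwich, op.
    now rewrite !assoc.
Qed.

(** * Basic products inside words *)

Section LeftRegular.
Context {A : Type} (mul : A -> A -> A).
Hypothesis assoc : forall a b c, mul a (mul b c) = mul (mul a b) c.
Local Infix "*" := mul.
Local Infix "~" := (IGeq mul) (at level 70).
Local Notation idem := (idem mul).

Lemma mul_head a b c : a * b = c -> forall x, a * (b * x) = c * x.
Proof. intros <- x. apply assoc. Qed.

Lemma basic_idem e f : idem e -> idem f -> basic mul e f -> idem (e * f).
Proof.
  unfold basic, omega_r, omega_l, Defs.idem. intros He Hf Hb.
  rewrite <- !assoc. destruct Hb as [H|[H|[H|H]]].
  - now rewrite (mul_head _ _ _ H), (mul_head _ _ _ He).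
  - now rewrite H, (mul_head _ _ _ H), He.
  - now rewrite H, Hf, H.
  - now rewrite (mul_head _ _ _ H), Hf.
Qed.

Lemma basic_word e f w :
  idem e -> idem f -> basic mul e f -> e :: f :: w ~ e * f :: w.
Proof.
  intros He Hf Hb. exact (cong_step _ [] w _ _ (IG_basic He Hf Hb)).
Qed.

Lemma word_omega_l e f w : idem e -> idem f -> e * f = e -> e :: f :: w ~ e :: w.
Proof.
  intros He Hf H. rewrite basic_word by (trivial; unfold basic, omega_l; tauto).
  now rewrite H.
Qed.

Lemma word_omega_r e f w : idem e -> idem f -> e * f = f -> e :: f :: w ~ f :: w.
Proof.
  intros He Hf H. rewrite basic_word by (trivial; unfold basic, omega_r; tauto).
  now rewrite H.
Qed.

(** Basic products are idempotent, so a relation trades letters of E only for letters of E. This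
    supplies well-formedness of words that arise from congruences. *)
Lemma Forall_idem_cong u v : u ~ v -> (Forall idem u <-> Forall idem v).
Proof.
  induction 1 as [a b l r H| | |]; try tauto.
  rewrite !Forall_app. destruct H as [e He|e f He Hf Hb]; rewrite !Forall_cons_iff.
  - tauto.
  - generalize (basic_idem _ _ He Hf Hb). tauto.
Qed.

(** * Values in the monoid [S^1] *)

Definition mulo (a b : option A) : option A :=
  match a, b with
  | Some x, Some y => Some (x * y)
  | None, _ => b
  | _, None => a
  end.
Local Infix "**" := mulo (at level 40, left associativity).

Lemma mulo_assoc a b c : a ** (b ** c) = a ** b ** c.
Proof. destruct a, b, c; simpl; now rewrite ?assoc. Qed.

Definition val (w : list A) : option A := fold_right (fun x => mulo (Some x)) None w.

Lemma val_app u v : val (u ++ v) = val u ** val v.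
Proof.
  induction u as [|x u IH]; trivial. cbn [app val fold_right].
  fold (val (u ++ v)) (val u). now rewrite IH, mulo_assoc.
Qed.

Lemma val_cons x v : val (x :: v) = Some x ** val v.
Proof. reflexivity. Qed.

Lemma val_cong u v : u ~ v -> val u = val v.
Proof.
  induction 1 as [a b l r H| | |]; try congruence.
  rewrite !val_app. do 2 f_equal. destruct H as [e He|e f He Hf Hb]; trivial.
  simpl. now rewrite He.
Qed.

(** Replaces a factor of S^1 by one of S: if [m] is [None], then [a = b] and idempotency lets [a]
    itself serve. *)
Lemma mulo_divisor a b m : idem b -> Some a ** m = Some b -> exists x, a * x = b.
Proof.
  intros Hb H. destruct m as [x|]; injection H; intros <-.
  - now exists x.
  - now exists a.
Qed.

(** * Elements of [IG(E)] which are L-related to a member of [E] *)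

Definition Lidem (s : list A) (g : A) : Prop :=
  idem g /\ s ++ [g] ~ s /\ exists z, z ++ s ~ [g].

Definition Lreg (s : list A) : Prop := exists g, Lidem s g.

Lemma Lidem_idem g : idem g -> Lidem [g] g.
Proof.
  intros Hg. repeat split; trivial.
  - now apply word_omega_l.
  - now exists [].
Qed.

Lemma Lidem_Forall s g : Lidem s g -> Forall idem s.
Proof.
  intros (Hg & _ & z & Hz). apply Forall_idem_cong in Hz.
  rewrite Forall_app in Hz. apply Hz. now constructor.
Qed.

Lemma Lidem_regular s g : Lidem s g -> regular_in mul (IGrel mul) s.
Proof.
  intros (Hg & Hs & z & Hz). exists (g :: z). split.
  - split; [discriminate|]. constructor; trivial.
    apply Forall_idem_cong in Hz. rewrite Forall_app in Hz.
    apply Hz. now constructor.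
  - change (s ++ [g] ++ z ++ s ~ s). now rewrite Hz, app_assoc, !Hs.
Qed.

(** Left multiplication by a word [z] with [z ++ s ~ [g]] cancels [s] down to [g]; then values are
    taken. *)
Lemma Lidem_val s g a b : Lidem s g -> s ++ a ~ s ++ b -> val (g :: a) = val (g :: b).
Proof.
  intros (_ & _ & z & Hz) H. apply val_cong.
  change ([g] ++ a ~ [g] ++ b). now rewrite <- Hz, <- !app_assoc, H.
Qed.

(** The hypothesis says that [g * f] is R-related to [g] in S. The idempotent [k = f * x * g] is
    L-related to [g], and [f * k = k] makes [k * f] a basic product. *)
Lemma transport_idem g f x : idem g -> idem f -> g * f * x = g ->
  exists k, idem k /\ g * k = g /\ k * g = k /\ f * k = k.
Proof.
  intros Hg Hf H. rewrite <- assoc in H. exists (f * (x * g)).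
  unfold Defs.idem in *.
  assert (E : g * (f * (x * g)) = g).
  { rewrite (assoc f), (assoc g), H. exact Hg. }
  repeat split; trivial.
  - rewrite <- !assoc. now rewrite E.
  - rewrite <- !assoc. now rewrite Hg.
  - now apply mul_head.
Qed.

(** As [k] is L-related to [g], it is a right unit of [s]; hence [s f = s k f = s (k * f)] in IG(E),
    the last product being basic. *)
Lemma Lidem_transport s g f k : Lidem s g ->
  idem f -> idem k -> g * k = g -> k * g = k -> f * k = k ->
  Lidem (s ++ [f]) (k * f) /\ s ++ [k] ~ s.
Proof.
  intros (Hg & Hs & z & Hz) Hf Hk Hgk Hkg Hfk.
  assert (Hkf : idem (k * f)) by (apply basic_idem; trivial; now left).
  assert (Bkf : forall w, k :: f :: w ~ k * f :: w)
    by (intros; apply basic_word; trivial; now left).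
  assert (Hsk : s ++ [k] ~ s).
  { rewrite <- Hs at 1. rewrite <- app_assoc. simpl.
    now rewrite word_omega_l. }
  assert (Hsf : s ++ [f] ~ s ++ [k * f]).
  { rewrite <- Hsk at 1. rewrite <- app_assoc. simpl. now rewrite Bkf. }
  split; trivial. repeat split; trivial.
  - rewrite Hsf, <- app_assoc. simpl. now rewrite word_omega_l.
  - exists (k :: z). rewrite Hsf. change (k :: z ++ s ++ [k * f] ~ [k * f]).
    rewrite app_assoc, Hz. simpl. rewrite word_omega_l by trivial.
    rewrite <- Bkf. now rewrite word_omega_l.
Qed.

(** Lifts an R-relation from S to IG(E): if [g v] is R-related to [g] in S, then so is [s v] to [s]
    in IG(E). The letters of [v] are appended one at a time. *)
Lemma Lidem_move v : Forall idem v -> forall s g m, Lidem s g ->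
  Some g ** val v ** m = Some g -> Lreg (s ++ v) /\ exists z, s ++ v ++ z ~ s.
Proof.
  induction 1 as [|f v Hf _ IH]; intros s g m Hs H.
  - rewrite app_nil_r. split; [now exists g|]. exists []. now rewrite app_nil_r.
  - rewrite val_cons, !mulo_assoc in H.
    assert (Hg : idem g) by apply Hs.
    destruct (mulo_divisor (g * f) g (val v ** m) Hg) as [x Hx].
    { now rewrite mulo_assoc. }
    destruct (transport_idem g f x) as (k & Hk & Hgk & Hkg & Hfk); trivial.
    destruct (Lidem_transport s g f k) as [Hsf Hsk]; trivial.
    (* The new return factor is [m f], since [(k f) v (m f) = k (g f v m) f = k g f = k f]. *)
    destruct (IH _ _ (m ** Some f) Hsf) as [H1 [z Hz]].
    + transitivity (Some k ** (Some g ** Some f ** val v ** m) ** Some f).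
      * replace (Some (k * f)) with (Some k ** (Some g ** Some f))
          by (simpl; now rewrite assoc, Hkg).
        now rewrite !mulo_assoc.
      * rewrite H. simpl. now rewrite Hkg.
    + rewrite <- app_assoc in H1. split; trivial.
      (* [z] leads from [s f v] back to [s f], and [k] from there to [s], because
         [s f k = s k = s]. *)
      exists (z ++ [k]). rewrite <- app_assoc in Hz. simpl in *.
      rewrite app_comm_cons, (app_assoc _ z), (app_assoc s), Hz.
      rewrite <- app_assoc. simpl. now rewrite word_omega_r.
Qed.

(** Being L-related to a member of E is inherited along an R-class of IG(E): [u a z = u] gives
    [g a z = g] in S, so [Lidem_move] applies. *)
Lemma Lreg_move u a z : Lreg u -> u ++ a ++ z ~ u -> Lreg (u ++ a).
Proof.
  intros [g Hg] H. apply (Lidem_move a) with g (val z); trivial.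
  - apply Lidem_Forall, Forall_idem_cong with (v := u ++ a ++ z) in Hg.
    2: now symmetry.
    rewrite !Forall_app in Hg. tauto.
  - rewrite <- mulo_assoc, <- val_app. rewrite <- val_cons.
    change (Some g) with (val (g :: [])). apply Lidem_val with u; trivial.
    now rewrite app_nil_r.
Qed.

(** Cancelling [u] turns [u e = u] into [g * e = g], so the [k] of [transport_idem] satisfies
    [k * e = k * g * e = k * g = k]. *)
Lemma Lreg_transport u e f z : Lreg u -> idem f -> u ++ f :: z ~ u -> u ++ [e] ~ u ->
  exists k, idem k /\ u ++ [k] ~ u /\ f * k = k /\ k * e = k.
Proof.
  intros [g Hg] Hf H He.
  assert (Hge : g * e = g).
  { assert (E : val (g :: [e]) = val [g])
      by (apply Lidem_val with u; trivial; now rewrite app_nil_r).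
    now injection E. }
  assert (Ig : idem g) by apply Hg.
  destruct (mulo_divisor (g * f) g (val z) Ig) as [x Hx].
  { change (Some (g * f)) with (Some g ** Some f).
    rewrite <- mulo_assoc, <- !val_cons. apply (Lidem_val _ _ _ [] Hg).
    now rewrite app_nil_r. }
  destruct (transport_idem g f x) as (k & Hk & Hgk & Hkg & Hfk); trivial.
  exists k. repeat split; trivial.
  - now apply (Lidem_transport u g f k).
  - rewrite <- Hkg, <- assoc. now rewrite Hge.
Qed.

(* The sandwich relation holds after [u] because [k f . h f = k f] is basic. *)
Lemma sandwich_after u e f h k : idem f -> sandwich mul e f h -> idem k ->
  u ++ [k] ~ u -> f * k = k -> k * e = k -> u ++ [h; f] ~ u ++ [f].
Proof.
  intros Hf (Hh & Hehf & Hfhe) Hk Huk Hfk Hke.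
  assert (Hfh : f * h = h).
  { rewrite <- Hfhe, <- assoc. now apply mul_head. }
  assert (Bhf : basic mul h f) by now left.
  assert (Bkf : basic mul k f) by now left.
  (* From [f * h = h] and [k * e = k], the product equals [k * e * h * f = k * e * f = k * f]. *)
  assert (E : k * f * (h * f) = k * f).
  { rewrite <- assoc, (mul_head _ _ _ Hfh).
    rewrite <- Hke at 1. rewrite <- assoc, (assoc e), Hehf.
    now rewrite assoc, Hke. }
  rewrite <- Huk, <- !app_assoc. simpl.
  rewrite <- (word_omega_r f h) by trivial.
  rewrite (basic_word h f), (basic_word k f) by trivial.
  rewrite word_omega_l by (trivial; now apply basic_idem).
  now rewrite basic_word.
Qed.

(* [RIG(E)] acts by partial maps on each regular R-class of [IG(E)]. *)
Lemma RIG_action w w' : RIGeq mul w w' -> forall u, Lreg u ->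
  (exists z, u ++ w ++ z ~ u) \/ (exists z, u ++ w' ++ z ~ u) -> u ++ w ~ u ++ w'.
Proof.
  induction 1 as [a b l r H|w|w w' _ IH|w1 w2 w3 _ IH1 _ IH2]; intros u Hu Hz.
  - destruct H as [l r H|e f h He Hf Hs].
    + now rewrite (cong_step (IGrel mul) a b _ _ H).
    + enough (E : (u ++ a ++ [e]) ++ [h; f] ~ (u ++ a ++ [e]) ++ [f]).
      { apply (fun E => cong_head _ _ _ _ E b) in E. rewrite <- !app_assoc in *.
        simpl in *. now symmetry. }
      assert (Hee : (u ++ a ++ [e]) ++ [e] ~ u ++ a ++ [e]).
      { rewrite <- !app_assoc. simpl. now rewrite word_omega_l. }
      assert (Hk : exists k, idem k /\ (u ++ a ++ [e]) ++ [k] ~ u ++ a ++ [e]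
                   /\ f * k = k /\ k * e = k).
      { destruct Hz as [[z Hz]|[z Hz]].
        - apply Lreg_transport with (b ++ z ++ a ++ [e]); trivial.
          + apply Lreg_move with (f :: b ++ z); trivial.
            rewrite <- !app_assoc in *. exact Hz.
          + apply (fun E => cong_head _ _ _ _ E (a ++ [e])) in Hz.
            rewrite <- !app_assoc in *. exact Hz.
        (* Here the return path starts with [h], giving [h * k = k]; then [f * k = k], because
           [h = f * h * e] implies [f * h = h]. *)
        - destruct (Lreg_transport (u ++ a ++ [e]) e h (f :: b ++ z ++ a ++ [e]))
            as (k & Hk & Huk & Hhk & Hke); trivial.
          + apply Lreg_move with (h :: f :: b ++ z); trivial.
            rewrite <- !app_assoc in *. exact Hz.
          + apply Hs.
          + apply (fun E => cong_head _ _ _ _ E (a ++ [e])) in Hz.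
            rewrite <- !app_assoc in *. exact Hz.
          + exists k. repeat split; trivial.
            destruct Hs as (_ & _ & Hfhe). rewrite <- Hhk at 1.
            rewrite <- Hfhe at 1. rewrite <- !assoc.
            rewrite (mul_head f f f Hf). rewrite (assoc h), (assoc f), (assoc f).
            now rewrite Hfhe. }
      destruct Hk as (k & Hk & Huk & Hfk & Hke).
      now apply sandwich_after with e k.
  - reflexivity.
  - symmetry. apply IH; tauto.
  - destruct Hz as [[z Hz]|[z Hz]].
    + assert (E : u ++ w1 ~ u ++ w2) by (apply IH1; trivial; left; now exists z).
      rewrite E. apply IH2; trivial. left. exists z.
      now rewrite app_assoc, <- E, <- app_assoc.
    + assert (E : u ++ w2 ~ u ++ w3) by (apply IH2; trivial; right; now exists z).
      rewrite <- E. apply IH1; trivial. right. exists z.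
      now rewrite app_assoc, E, <- app_assoc.
Qed.

(** * Sandwich sets and lifting from RIG(E) to IG(E) *)

(** From [y] with [e f y e f = e f] one gets an inverse [z = y e f y] of [e f]; then [f z e] is in
    the sandwich set. *)
Lemma sandwich_nonempty e f : (forall a, exists x, a * x * a = a) -> idem e -> idem f ->
  exists h, sandwich mul e f h.
Proof.
  intros reg He Hf. destruct (reg (e * f)) as [y Hy].
  set (z := y * (e * f * y)).
  assert (H1 : e * f * z * (e * f) = e * f).
  { unfold z. rewrite !assoc in *. now rewrite !Hy. }
  assert (H2 : z * (e * f * z) = z).
  { unfold z. rewrite !assoc in *.
    replace (y * e * f * y * e * f * y * e * f * y) with
      (y * (e * f * y * e * f) * y * e * f * y) by now rewrite !assoc.
    rewrite Hy.
    replace (y * (e * f) * y * e * f * y) with (y * (e * f * y * e * f) * y)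
      by now rewrite !assoc.
    now rewrite Hy, !assoc. }
  exists (f * (z * e)). unfold sandwich, Defs.idem in *. repeat split.
  - rewrite <- H2 at 3. now rewrite !assoc.
  - rewrite <- H1. now rewrite !assoc.
  - rewrite !assoc, Hf. rewrite <- !assoc. now rewrite He.
Qed.

(** Before each new letter [f] an element [h] of the sandwich set of [g], [f] is inserted; this
    changes nothing in RIG(E). *)
Lemma RIG_lift r : (forall a, exists x, a * x * a = a) -> Forall idem r -> r <> [] ->
  exists s g, Lidem s g /\ s <> [] /\ RIGeq mul s r.
Proof.
  intros reg. induction r as [|f r IH] using rev_ind; [easy|].
  rewrite Forall_app, Forall_cons_iff. intros (Hr & Hf & _) _.
  destruct r as [|x r].
  { exists [f], f. repeat split; try easy; try now apply Lidem_idem. }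
  destruct IH as (s & g & Hs & Hne & E); try easy.
  assert (Hg : idem g) by apply Hs.
  destruct (sandwich_nonempty g f reg Hg Hf) as [h Hh].
  assert (Hfh : f * h = h).
  { destruct Hh as (_ & _ & <-). rewrite <- !assoc. now apply mul_head. }
  assert (Hhg : h * g = h).
  { destruct Hh as (_ & _ & <-). rewrite <- !assoc. now rewrite Hg. }
  assert (Ih : idem h) by apply Hh.
  assert (H1 : Lidem (s ++ [h]) h).
  { destruct Hs as (_ & Hs & z & Hz). repeat split; trivial.
    - rewrite <- app_assoc. simpl. now rewrite word_omega_l.
    - exists (h :: z). simpl. rewrite app_assoc, Hz. simpl.
      rewrite word_omega_l by trivial. now apply word_omega_l. }
  exists ((s ++ [h]) ++ [f]), (h * f). split; [|split].
  (* [h] plays both the L-related idempotent and the transporting [k], since [f * h = h]. *)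
  - now apply (Lidem_transport (s ++ [h]) h f h).
  - now destruct s.
  - rewrite <- E. rewrite <- app_assoc. destruct Hs as (_ & Hs & _).
    apply IGeq_RIGeq in Hs. rewrite <- Hs, <- !app_assoc. symmetry.
    generalize (cong_step (RIGrel mul) s [] _ _ (RIG_sandwich Hg Hf Hh)).
    now rewrite !app_nil_r.
Qed.

End LeftRegular.

(** * Left-right duals by reversal of words *)

Section Dual.
Context {A : Type} (mul : A -> A -> A).
Hypothesis assoc : forall a b c, mul a (mul b c) = mul (mul a b) c.
Local Infix "~" := (IGeq mul) (at level 70).
Local Notation idem := (idem mul).

Definition Ridem (s : list A) (g : A) : Prop :=
  idem g /\ g :: s ~ s /\ exists z, s ++ z ~ [g].

Lemma op_assoc a b c : op mul a (op mul b c) = op mul (op mul a b) c.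
Proof. symmetry. apply assoc. Qed.

Lemma IGeq_rev u v : IGeq (op mul) (rev u) (rev v) -> u ~ v.
Proof.
  intros H. apply IGeq_op in H. now rewrite !rev_involutive in H.
Qed.

Lemma Lidem_op s g : Lidem (op mul) (rev s) g -> Ridem s g.
Proof.
  intros (Hg & Hs & z & Hz). repeat split; trivial.
  - now apply IGeq_rev.
  - exists (rev z). apply IGeq_rev. now rewrite rev_app_distr, rev_involutive.
Qed.

Lemma RIG_action_left w w' g : RIGeq mul w w' -> idem g ->
  (exists z, z ++ w ++ [g] ~ [g]) -> w ++ [g] ~ w' ++ [g].
Proof.
  intros H Hg [z Hz]. apply IGeq_rev. rewrite !rev_app_distr.
  apply (RIG_action (op mul) op_assoc).
  - now apply RIGeq_op.
  - exists g. now apply Lidem_idem.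
  - left. exists (rev z). apply IGeq_op in Hz. now rewrite !rev_app_distr in Hz.
Qed.

Lemma mulo_op a b : mulo (op mul) a b = mulo mul b a.
Proof. now destruct a, b. Qed.

Lemma val_op u : val (op mul) (rev u) = val mul u.
Proof.
  induction u as [|x u IH]; trivial. simpl rev.
  now rewrite val_app, mulo_op, IH by apply op_assoc.
Qed.

(** Dual of [Lidem_move] at a one-letter word: an L-relation between [u s] and [s] lifts from S to
    IG(E). *)
Lemma Lidem_move_left u s m : Forall idem u -> idem s ->
  mulo mul m (mulo mul (val mul u) (Some s)) = Some s -> exists z, z ++ u ++ [s] ~ [s].
Proof.
  intros Hu Hs H.
  destruct (Lidem_move (op mul) op_assoc (rev u)) with (s := [s]) (g := s) (m := m)
    as [_ [z Hz]].
  - now apply Forall_rev.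
  - now apply Lidem_idem.
  - now rewrite val_op, !mulo_op.
  - exists (rev z). apply IGeq_rev. now rewrite !rev_app_distr, rev_involutive, <- app_assoc.
Qed.
End Dual.

(** * Seeds *)

Section Seeds.
Context {A : Type} (mul : A -> A -> A).
Hypothesis assoc : forall a b c, mul a (mul b c) = mul (mul a b) c.
Hypothesis reg : forall a, exists x, mul (mul a x) a = a.
Local Infix "*" := mul.
Local Infix "~" := (IGeq mul) (at level 70).
Local Notation idem := (idem mul).
Local Infix "**" := (mulo mul) (at level 40, left associativity).
Local Notation val := (val mul).

Lemma mulo_val_nil m : m ** val [] = m.
Proof. now destruct m. Qed.

Let mulo_assoc := mulo_assoc mul assoc.
Let val_app := val_app mul assoc.

(* [m s] is L-related to [s], resp. [s m] is R-related to [s], in [S^1]. *)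
Definition Labsorb (m : option A) (s : A) : Prop := exists z, z ** (m ** Some s) = Some s.
Definition Rabsorb (s : A) (m : option A) : Prop := exists z, Some s ** m ** z = Some s.

Definition seeded (w : list A) : Prop :=
  exists u s v, w = u ++ s :: v /\ Labsorb (val u) s /\ Rabsorb s (val v).

Lemma Labsorb_suffix m n s : Labsorb (m ** n) s -> Labsorb n s.
Proof. intros [z H]. exists (z ** m). now rewrite <- !mulo_assoc in *. Qed.

Lemma Rabsorb_prefix s m n : Rabsorb s (m ** n) -> Rabsorb s m.
Proof. intros [z H]. exists (n ** z). now rewrite !mulo_assoc in *. Qed.

Lemma Labsorb_mul m e f : Labsorb m e -> Labsorb m (e * f).
Proof.
  intros [z H]. exists z. change (Some (e * f)) with (Some e ** Some f).
  now rewrite (mulo_assoc m), (mulo_assoc z), H.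
Qed.

Lemma Rabsorb_mul e f m : Rabsorb f m -> Rabsorb (e * f) m.
Proof.
  intros [z H]. exists z. change (Some (e * f)) with (Some e ** Some f).
  now rewrite <- !mulo_assoc, (mulo_assoc (Some f)), H.
Qed.

(** The factor without the seed enters only through its value, so rewriting inside it cannot destroy
    the seed. *)
Lemma seeded_app a b : seeded (a ++ b) ->
  (exists u s v, a = u ++ s :: v /\ Labsorb (val u) s /\ Rabsorb s (val v ** val b)) \/
  (exists u s v, b = u ++ s :: v /\ Labsorb (val a ** val u) s /\ Rabsorb s (val v)).
Proof.
  intros (u & s & v & E & Hu & Hv). apply app_eq_app in E.
  destruct E as [l [[-> E]|[-> ->]]].
  - destruct l as [|x l].
    (* The cut falls just before the seed, which is then the first letter of [b]. *)
    + right. exists [], s, v. rewrite app_nil_r. simpl in E. subst.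
      now rewrite mulo_val_nil.
    + injection E as -> ->. left. exists u, x, l. now rewrite <- val_app.
  - right. exists l, s, v. now rewrite <- val_app.
Qed.

Lemma seeded_app_l a b u s v : a = u ++ s :: v ->
  Labsorb (val u) s -> Rabsorb s (val v ** val b) -> seeded (a ++ b).
Proof.
  intros -> Hu Hv. exists u, s, (v ++ b). now rewrite <- app_assoc, val_app.
Qed.

Lemma seeded_app_r a b u s v : b = u ++ s :: v ->
  Labsorb (val a ** val u) s -> Rabsorb s (val v) -> seeded (a ++ b).
Proof.
  intros -> Hu Hv. exists (a ++ u), s, v. now rewrite <- app_assoc, val_app.
Qed.

Lemma seeded_letter e : idem e -> seeded [e].
Proof.
  intros He. exists [], e, []. repeat split; exists (Some e); simpl; now rewrite He.
Qed.

(** If [e] or [f] is the seed, [e * f] takes over, since L is a right and R a left congruence. *)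
Lemma seeded_basic a e f b :
  seeded (a ++ e :: f :: b) -> seeded (a ++ e * f :: b).
Proof.
  intros H. apply seeded_app in H.
  destruct H as [(u & s & v & E & Hu & Hv)|(u & s & v & E & Hu & Hv)].
  - apply seeded_app_l with u s v; trivial.
    rewrite !val_cons, (mulo_assoc (Some e)) in *. exact Hv.
  - destruct u as [|x [|y u]]; injection E; intros; subst.
    + rewrite mulo_val_nil in Hu. exists a, (s * f), b. split; [|split]; trivial.
      * now apply Labsorb_mul.
      * destruct Hv as [z Hz]. exists (z ** Some f).
        change (Some (s * f)) with (Some s ** Some f) at 2. rewrite <- Hz.
        change (Some (s * f)) with (Some s ** Some f).
        now rewrite val_cons, !mulo_assoc.
    + exists a, (x * s), v. split; [|split]; trivial.
      * destruct Hu as [z Hz]. exists (Some x ** z).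
        change (Some (x * s)) with (Some x ** Some s) at 2. rewrite <- Hz.
        change (Some (x * s)) with (Some x ** Some s).
        change (val [x]) with (Some x). now rewrite !mulo_assoc.
      * now apply Rabsorb_mul.
    + apply seeded_app_r with (x * y :: u) s v; trivial.
      rewrite !val_cons, (mulo_assoc (Some x)) in Hu. exact Hu.
Qed.

(** If the seed is [e * f], one of its letters takes over: the product is R-related to [e] for the
    first two kinds of basic product and L-related to [f] for the other two. *)
Lemma seeded_unbasic a e f b : idem e -> idem f -> basic mul e f ->
  seeded (a ++ e * f :: b) -> seeded (a ++ e :: f :: b).
Proof.
  intros He Hf Hb H. apply seeded_app in H.
  destruct H as [(u & s & v & E & Hu & Hv)|(u & s & v & E & Hu & Hv)].
  { apply seeded_app_l with u s v; trivial.
    rewrite !val_cons, (mulo_assoc (Some e)). exact Hv. }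
  destruct u as [|x u]; injection E; intros; subst.
  2:{ apply seeded_app_r with (e :: f :: u) s v; trivial.
      rewrite !val_cons, (mulo_assoc (Some e)). exact Hu. }
  rewrite mulo_val_nil in Hu. clear E.
  destruct Hu as [z Hz], Hv as [z' Hz'].
  destruct Hb as [H|[H|[H|H]]]; red in H.
  - assert (E : Some (e * f) ** Some e = Some e)
      by (simpl; now rewrite <- assoc, H, He).
    exists a, e, (f :: v). repeat split.
    + exists z. rewrite <- E. now rewrite (mulo_assoc (val a)), mulo_assoc, Hz.
    + exists (z' ** Some e). rewrite val_cons, !mulo_assoc.
      change (Some e ** Some f) with (Some (e * f)). now rewrite Hz', E.
  - rewrite H in *. exists a, e, (f :: v). repeat split.
    + now exists z.
    + exists z'. rewrite val_cons, !mulo_assoc.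
      change (Some e ** Some f) with (Some (e * f)). now rewrite H.
  - rewrite H in *. apply seeded_app_r with [e] f v; trivial.
    + exists z. change (val [e]) with (Some e). rewrite <- (mulo_assoc (val a)).
      change (Some e ** Some f) with (Some (e * f)). now rewrite H.
    + now exists z'.
  - assert (E : Some f ** Some (e * f) = Some f)
      by (simpl; now rewrite assoc, H, Hf).
    apply seeded_app_r with [e] f v; trivial.
    + exists (Some f ** z). change (val [e]) with (Some e).
      rewrite <- (mulo_assoc (val a)).
      change (Some e ** Some f) with (Some (e * f)). now rewrite <- mulo_assoc, Hz.
    + exists z'. rewrite <- E at 1. now rewrite <- !mulo_assoc, (mulo_assoc (Some (e * f))), Hz'.
Qed.

(* A basic product joining the ends of two seeded words can be absorbed in
   one of them, unless it becomes a seed of the whole word. *)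
Lemma seeded_straddle a e f b : basic mul e f -> idem e -> idem f ->
  seeded (a ++ [e]) -> seeded ([f] ++ b) ->
  seeded (a ++ e * f :: b) \/ (seeded a /\ seeded (e * f :: b)) \/
  (seeded (a ++ [e * f]) /\ seeded b).
Proof.
  intros Hb He Hf Ha Hfb. apply seeded_app in Ha, Hfb.
  destruct Ha as [(u & s & v & Ea & Hu & Hv)|(u & s & v & Ea & Hu & Hv)];
  destruct Hfb as [(u' & s' & v' & Eb & Hu' & Hv')|(u' & s' & v' & Eb & Hu' & Hv')].
  - destruct u' as [|x [|]]; try discriminate. injection Eb; intros; subst.
    right; left. split.
    + exists u, s, v. repeat split; trivial. now apply Rabsorb_prefix with (val [e]).
    + exists [], (e * s'), b. repeat split.
      * exists (Some (e * s')). simpl. f_equal. now apply basic_idem.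
      * now apply Rabsorb_mul.
  (* Neither seed is at the junction. If [e * f] is R-related to [e], it can replace [e] on the
     left; otherwise it is L-related to [f] and can replace [f] on the right. *)
  - assert (Sa : seeded a) by (exists u, s, v; repeat split; trivial;
      now apply Rabsorb_prefix with (val [e])).
    assert (Sb : seeded b) by (exists u', s', v'; repeat split; trivial;
      now apply Labsorb_suffix with (val [f])).
    right. destruct Hb as [H|[H|[H|H]]]; red in H.
    + right. split; trivial. apply seeded_app_l with u s v; trivial.
      destruct Hv as [z Hz]. exists (Some e ** z).
      rewrite <- Hz at 2. change (val [e]) with (Some e).
      rewrite !mulo_assoc. f_equal. rewrite <- !mulo_assoc. do 2 f_equal. simpl.
      now rewrite <- assoc, H, He.
    + right. split; trivial. rewrite H. now apply seeded_app_l with u s v.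
    + left. split; trivial. rewrite H. now apply (seeded_app_r [f]) with u' s' v'.
    + left. split; trivial. apply (seeded_app_r [e * f]) with u' s' v'; trivial.
      destruct Hu' as [z Hz]. exists (z ** Some f).
      rewrite <- Hz at 2. change (val [f]) with (Some f).
      rewrite <- !mulo_assoc. f_equal. rewrite !mulo_assoc. do 2 f_equal. simpl.
      now rewrite assoc, H, Hf.
  (* Both [e] and [f] are seeds, so [e * f] is a seed of the merged word. *)
  - destruct u as [|x [|]]; try discriminate. injection Ea; intros; subst.
    destruct u' as [|x [|]]; try discriminate. injection Eb; intros; subst.
    rewrite mulo_val_nil in Hu. left. exists a, (s * s'), b. repeat split.
    + now apply Labsorb_mul.
    + now apply Rabsorb_mul.
  - destruct u as [|x [|]]; try discriminate. injection Ea; intros; subst.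
    rewrite mulo_val_nil in Hu. right; right. split.
    + exists a, (s * f), []. repeat split.
      * now apply Labsorb_mul.
      * now exists None.
    + exists u', s', v'. repeat split; trivial. now apply Labsorb_suffix with (val [f]).
Qed.

(** * Factorizations into seeded words *)

(** Weakening makes the number an upper bound, so a merger of two factors still preserves it. *)
Inductive factors : nat -> list A -> Prop :=
| factors_nil : factors 0 []
| factors_cons n a b : seeded a -> factors n b -> factors (S n) (a ++ b)
| factors_weaken n w : factors n w -> factors (S n) w.

Lemma factors_le n m w : factors n w -> n <= m -> factors m w.
Proof.
  intros H. induction 1; trivial. now apply factors_weaken.
Qed.

Lemma factors_snoc n a b : factors n a -> seeded b -> factors (S n) (a ++ b).
Proof.
  intros H Hb. induction H as [|n a a' Ha _ IH|n a _ IH].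
  - rewrite <- app_nil_r. apply factors_cons; trivial. apply factors_nil.
  - rewrite <- app_assoc. now apply factors_cons.
  - now apply factors_weaken.
Qed.

Lemma seeded_nil : ~ seeded [].
Proof. intros (u & s & v & E & _). now destruct u. Qed.

Lemma factors_head n x w : factors n (x :: w) ->
  exists m a b, n = S m /\ w = a ++ b /\ seeded (x :: a) /\ factors m b.
Proof.
  intros H. remember (x :: w) as y eqn:E. revert E.
  induction H as [|n a b Ha Hb _|n y _ IH]; intros E.
  - discriminate.
  - destruct a as [|x' a]; [now apply seeded_nil in Ha|].
    injection E; intros; subst. now exists n, a, b.
  - destruct (IH E) as (m & a & b & -> & E' & Ha & Hb).
    exists (S m), a, b. repeat split; trivial. now apply factors_weaken.
Qed.

Lemma factors_one w : w <> [] -> factors 1 w -> seeded w.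
Proof.
  destruct w as [|x w]; [easy|]. intros _ H. apply factors_head in H.
  destruct H as (m & a & b & E & -> & Ha & Hb). injection E; intros; subst.
  inversion Hb. now rewrite app_nil_r.
Qed.

Lemma seeded_factors w : seeded w -> factors 1 w.
Proof.
  intros H. rewrite <- app_nil_r. apply factors_cons; trivial. apply factors_nil.
Qed.

Lemma factors_unbasic n u e f v : idem e -> idem f -> basic mul e f ->
  factors n (u ++ e * f :: v) -> factors n (u ++ e :: f :: v).
Proof.
  intros He Hf Hb H. remember (u ++ e * f :: v) as w eqn:E. revert u E.
  induction H as [|n a b Ha Hf' IH|n w _ IH]; intros u E.
  - now destruct u.
  - apply app_eq_app in E. destruct E as [l [[-> E]|[-> ->]]].
    + destruct l as [|x l].
      * rewrite app_nil_r in *. apply factors_cons; trivial.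
        apply (IH []). now symmetry.
      * injection E; intros; subst. rewrite 2!app_comm_cons, app_assoc.
        apply factors_cons; trivial. now apply seeded_unbasic.
    + rewrite <- app_assoc. apply factors_cons; trivial. now apply IH.
  - apply factors_weaken. now apply IH.
Qed.

Lemma factors_basic n u e f v : idem e -> idem f -> basic mul e f ->
  factors n (u ++ e :: f :: v) -> factors n (u ++ e * f :: v).
Proof.
  intros He Hf Hb H. remember (u ++ e :: f :: v) as w eqn:E. revert u E.
  induction H as [|n a b Ha Hf' IH|n w _ IH]; intros u E.
  - now destruct u.
  - apply app_eq_app in E. destruct E as [l [[-> E]|[-> ->]]].
    + destruct l as [|x [|y l]].
      * rewrite app_nil_r in *. apply factors_cons; trivial.
        apply (IH []). now symmetry.
      (* The cut separates [e] from [f]; [f :: c] is the factor after the cut. *)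
      * injection E; intros; subst. apply factors_head in Hf'.
        destruct Hf' as (m & c & d & -> & -> & Hc & Hd).
        destruct (seeded_straddle u x f c) as [H|[[H1 H2]|[H1 H2]]]; trivial.
        -- apply factors_weaken. rewrite app_comm_cons, app_assoc.
           now apply factors_cons.
        -- apply factors_cons; trivial. now apply (factors_cons m (x * f :: c)).
        -- change (x * f :: c ++ d) with ([x * f] ++ c ++ d). rewrite app_assoc.
           apply factors_cons; trivial. now apply factors_cons.
      * injection E; intros; subst. rewrite app_comm_cons, app_assoc.
        apply factors_cons; trivial. now apply seeded_basic.
    + rewrite <- app_assoc. apply factors_cons; trivial. now apply IH.
  - apply factors_weaken. now apply IH.
Qed.

Lemma factors_cong w w' : w ~ w' -> forall n, factors n w <-> factors n w'.
Proof.
  induction 1 as [u v l r H|w|w w' _ IH|w1 w2 w3 _ IH1 _ IH2]; intros n.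
  - destruct H as [e He|e f He Hf Hb].
    + assert (Hb : basic mul e e) by now left.
      generalize (factors_basic n u e e v He He Hb).
      generalize (factors_unbasic n u e e v He He Hb).
      unfold Defs.idem in He. rewrite He. now split.
    + split; [now apply factors_basic|now apply factors_unbasic].
  - reflexivity.
  - now rewrite IH.
  - now rewrite IH1.
Qed.

Lemma factors_word w : Forall idem w -> factors (length w) w.
Proof.
  induction 1 as [|x w Hx _ IH]; [apply factors_nil|].
  apply (factors_cons _ [x]); trivial. now apply seeded_letter.
Qed.

(** [a ++ b] is a factor at the border, possibly lying on one side of it; [y <> []] ensures that
    there is a factor at all. *)
Lemma factors_split n x y : factors n (x ++ y) -> y <> [] ->
  exists i j x1 a b y1, x = x1 ++ a /\ y = b ++ y1 /\ seeded (a ++ b) /\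
    factors i x1 /\ factors j y1 /\ i + j < n.
Proof.
  intros H Hy. remember (x ++ y) as w eqn:E. revert x E.
  induction H as [|n a b Ha Hb IH|n w _ IH]; intros x E.
  - destruct x; simpl in E; now subst.
  - apply app_eq_app in E. destruct E as [l [[-> ->]|[-> ->]]].
    + exists 0, n, [], x, l, b. repeat split; trivial; [apply factors_nil|lia].
    + destruct (IH l eq_refl) as (i & j & x1 & c & d & y1 & -> & -> & Hs & Hi & Hj & Hn).
      exists (S i), j, (a ++ x1), c, d, y1. rewrite app_assoc.
      repeat split; trivial; [now apply factors_cons|lia].
  - destruct (IH x E) as (i & j & x1 & c & d & y1 & Hx & Hy' & Hs & Hi & Hj & Hn).
    exists i, j, x1, c, d, y1. repeat split; trivial. lia.
Qed.

(** * Seeds of idempotent and regular elements *)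

Lemma mulo_regular t : exists t', t ** t' ** t = t.
Proof.
  destruct t as [t|]; [|now exists None].
  destruct (reg t) as [x Hx]. exists (Some x). simpl. now rewrite Hx.
Qed.

(** For the idempotent [g = t t'], [g p = p] and [q p g = g], so
    [p g = g p g = q p g p g = q p p g = g], whence [p t = t]. *)
Lemma idem_Rabsorb p t k q : p ** p = p -> p = t ** k -> q ** p ** t = t ->
  t ** k ** t = t.
Proof.
  intros Hp Ep Hq. destruct (mulo_regular t) as [t' Ht].
  pose (g := t ** t').
  assert (Hgp : g ** p = p) by (unfold g; rewrite Ep, mulo_assoc, Ht; trivial).
  assert (Hqg : q ** p ** g = g) by (unfold g; now rewrite mulo_assoc, Hq).
  assert (Hpg : p ** g = g).
  { transitivity (q ** p ** g ** p ** g); [now rewrite Hqg, Hgp|].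
    now rewrite <- (mulo_assoc (q ** p)), Hgp, <- (mulo_assoc q), Hp. }
  rewrite <- Ep, <- Ht. fold g. now rewrite mulo_assoc, Hpg.
Qed.

Lemma idem_Labsorb p t k q : p ** p = p -> p = k ** t -> t ** (p ** q) = t ->
  t ** (k ** t) = t.
Proof.
  intros Hp Ep Hq. destruct (mulo_regular t) as [t' Ht].
  pose (g := t' ** t).
  assert (Hpg : p ** g = p)
    by (unfold g; rewrite Ep, <- mulo_assoc, (mulo_assoc t), Ht; trivial).
  assert (Hgq : g ** (p ** q) = g) by (unfold g; now rewrite <- mulo_assoc, Hq).
  assert (Hgp : g ** p = g).
  { transitivity (g ** (p ** (g ** (p ** q)))); [now rewrite Hgq, Hpg|].
    now rewrite (mulo_assoc p g), Hpg, (mulo_assoc p p), Hp. }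
  rewrite <- Ep, <- Ht, <- (mulo_assoc t). fold g. now rewrite <- mulo_assoc, Hgp.
Qed.

(** The border factor of [p p] has its seed in [a] or in [b]. It yields a factorization of one copy
    of [p] into [i + 1] or [j + 1] words, so the bound descends unless the other count is 0. *)
Lemma idem_seeded p : Forall idem p -> p <> [] -> p ++ p ~ p -> seeded p.
Proof.
  intros Hp Hne Hpp.
  assert (Hv : val p ** val p = val p) by (rewrite <- val_app; now apply val_cong).
  generalize (factors_word p Hp). generalize (length p) as n.
  induction n as [|n IH]; intros H.
  { inversion H. now subst. }
  apply (factors_cong _ _ Hpp), factors_split in H; trivial.
  destruct H as (i & j & x1 & a & b & y1 & Ex & Ey & Hs & Hi & Hj & Hn).
  apply seeded_app in Hs.
  destruct Hs as [(u & s & v & E & Hu & Hs)|(u & s & v & E & Hu & Hs)].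
  - destruct j as [|j].
    + inversion Hj; subst y1. rewrite app_nil_r in Ey. subst b.
      rewrite Ex. apply seeded_app_r with u s v; trivial.
      2: now apply Rabsorb_prefix with (val p).
      destruct Hs as [z Hz].
      (* With [t = s v] and [p = k t], the identity [t k t = t] shows that [s] absorbs all of [p]
         before it. *)
      assert (Ht : Some s ** val v ** (val x1 ** val u ** (Some s ** val v)) = Some s ** val v).
      { apply idem_Labsorb with (val p) (z ** val v); trivial.
        - now rewrite Ex, E, !val_app, val_cons, !mulo_assoc.
        - rewrite !mulo_assoc in *. now rewrite Hz. }
      exists (Some s ** val v). rewrite !mulo_assoc in *.
      rewrite <- Hz at 2 3. rewrite !mulo_assoc. now rewrite Ht.
    + apply IH, factors_le with (i + 1); [|lia].
      rewrite Ex, Nat.add_1_r. apply factors_snoc; trivial.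
      exists u, s, v. repeat split; trivial. now apply Rabsorb_prefix with (val b).
  - destruct i as [|i].
    + inversion Hi; subst x1. simpl in Ex. subst a.
      rewrite Ey. apply seeded_app_l with u s v; trivial.
      { now apply Labsorb_suffix with (val p). }
      destruct Hu as [z Hz].
      assert (Ht : val u ** Some s ** (val v ** val y1) ** (val u ** Some s) = val u ** Some s).
      { apply idem_Rabsorb with (val p) (val u ** z); trivial.
        - now rewrite Ey, E, !val_app, val_cons, !mulo_assoc.
        - rewrite <- !mulo_assoc in *. now rewrite Hz. }
      exists (val u ** Some s). rewrite <- !mulo_assoc in *.
      rewrite <- Hz at 1 3. rewrite <- !mulo_assoc. now rewrite Ht.
    + apply IH. rewrite Ey. apply factors_le with (S j); [|lia].
      apply factors_cons; trivial. exists u, s, v. repeat split; trivial.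
      now apply Labsorb_suffix with (val a).
Qed.

(** The idempotent [w x] has a seed. In [w] it is a seed of [w]; in [x] it seeds [w x w], and
    invariance of [factors 1] carries this to [w]. *)
Lemma regular_seeded w : wf mul w -> regular_in mul (IGrel mul) w -> seeded w.
Proof.
  intros [Hne Hw] (x & [_ Hx] & H).
  assert (E : val w ** val x ** val w = val w).
  { rewrite <- !val_app, <- app_assoc. now apply val_cong. }
  assert (Hs : seeded (w ++ x)).
  { apply idem_seeded.
    - now apply Forall_app.
    - now destruct w.
    - apply (cong_head _ _ _ _) with (w := x) in H. now rewrite <- !app_assoc in *. }
  apply seeded_app in Hs.
  destruct Hs as [(a & s & b & Ew & Ha & Hb)|(a & s & b & Ew & Ha & Hb)].
  - exists a, s, b. repeat split; trivial. now apply Rabsorb_prefix with (val x).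
  - apply factors_one; trivial. apply (factors_cong _ _ H), seeded_factors.
    rewrite app_assoc. apply seeded_app_l with (w ++ a) s b.
    + now rewrite Ew, app_assoc.
    + now rewrite val_app.
    (* With [s = z w a s] and [s = s b z']: [s b w x z' = z w x w x z' = z w x z' = s]. *)
    + destruct Ha as [z Hz], Hb as [z' Hz']. exists (val x ** z').
      rewrite <- Hz' at 2. rewrite <- Hz.
      assert (Ex : val x = val a ** Some s ** val b)
        by (now rewrite Ew, val_app, val_cons, mulo_assoc).
      transitivity (z ** (val w ** val x ** val w ** val x ** z')).
      * rewrite Ex at 2. now rewrite !mulo_assoc.
      * rewrite E, Ex. now rewrite !mulo_assoc.
Qed.

(** In IG(E), [u s] is L-related to its seed [s], and appending [v] stays in its R-class. *)
Lemma seeded_Lreg w : Forall idem w -> seeded w -> Lreg mul w.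
Proof.
  intros Hw (u & s & v & -> & [m Hm] & [m' Hm']).
  rewrite Forall_app, Forall_cons_iff in Hw. destruct Hw as (Hu & Hs & Hv).
  destruct (Lidem_move_left mul assoc u s m Hu Hs Hm) as [z Hz].
  change (u ++ s :: v) with (u ++ [s] ++ v). rewrite app_assoc.
  apply (Lidem_move mul assoc v Hv (u ++ [s]) s m'); trivial.
  repeat split; trivial.
  - rewrite <- app_assoc. simpl. now rewrite word_omega_l.
  - now exists z.
Qed.

Lemma regular_Lreg w : wf mul w -> regular_in mul (IGrel mul) w -> Lreg mul w.
Proof.
  intros Hw H. apply seeded_Lreg; [apply Hw|]. now apply regular_seeded.
Qed.
End Seeds.

(** * The bijection on regular elements and maximal subgroups *)

Section RegularElements.
Context {A : Type} (mul : A -> A -> A).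
Hypothesis assoc : forall a b c, mul a (mul b c) = mul (mul a b) c.
Hypothesis reg : forall a, exists x, mul (mul a x) a = a.
Local Infix "~" := (IGeq mul) (at level 70).
Local Notation regular := (regular_in mul (IGrel mul)).

Lemma wf_rev w : wf mul w -> wf (op mul) (rev w).
Proof.
  intros [Hne Hw]. split.
  - intros E. apply Hne. now rewrite <- (rev_involutive w), E.
  - now apply Forall_rev.
Qed.

Lemma regular_Ridem w : wf mul w -> regular w -> exists g, Ridem mul w g.
Proof.
  intros Hw (x & Hx & H).
  destruct (regular_Lreg (op mul) (op_assoc mul assoc)) with (w := rev w) as [g Hg].
  - intros a. destruct (reg a) as [y Hy]. exists y. unfold op. now rewrite assoc.
  - now apply wf_rev.
  - exists (rev x). split; [now apply wf_rev|].
    apply IGeq_op in H. now rewrite !rev_app_distr, <- app_assoc in H.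
  - exists g. now apply Lidem_op.
Qed.

(** Both words act from the left on the idempotent [g] L-related to [s], with the same result. *)
Lemma RIG_absorb_left s s' : wf mul s -> regular s -> RIGeq mul s s' ->
  exists g, s ++ [g] ~ s /\ s' ++ [g] ~ s.
Proof.
  intros Hs Rs E. destruct (regular_Lreg mul assoc reg s Hs Rs) as (g & Hg & Hsg & z & Hz).
  exists g. split; trivial. rewrite <- Hsg. symmetry.
  apply RIG_action_left; trivial. exists z. now rewrite Hsg.
Qed.

Lemma RIG_absorb_right s s' : wf mul s -> regular s -> RIGeq mul s s' ->
  exists g, g :: s ~ s /\ g :: s' ~ s.
Proof.
  intros Hs Rs E. destruct (regular_Ridem s Hs Rs) as (g & Hg & Hsg & z & Hz).
  exists g. split; trivial. rewrite <- Hsg. symmetry.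
  apply (RIG_action mul assoc s s' E [g]).
  - exists g. now apply Lidem_idem.
  - left. exists z. rewrite Hz. now apply word_omega_l.
Qed.

(** With left unit [g] of [s] and right unit [g'] of [s']: [s = g s' = g s g' = s g' = s']. *)
Lemma regular_RIG_inj s s' : wf mul s -> wf mul s' -> regular s -> regular s' ->
  RIGeq mul s s' -> s ~ s'.
Proof.
  intros Hs Hs' Rs Rs' E.
  destruct (RIG_absorb_right s s' Hs Rs E) as (g & H1 & H2).
  destruct (RIG_absorb_left s' s Hs' Rs') as (g' & H3 & H4).
  { now symmetry. }
  rewrite <- H2. rewrite <- H4 at 1. rewrite app_comm_cons, H1. exact H4.
Qed.

Lemma regular_RIG_surj r : wf mul r ->
  exists s, wf mul s /\ regular s /\ RIGeq mul s r.
Proof.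
  intros [Hne Hr]. destruct (RIG_lift mul assoc r reg Hr Hne) as (s & g & Hs & Hs0 & E).
  exists s. repeat split; trivial.
  - now apply Lidem_Forall with g.
  - now apply Lidem_regular with g.
Qed.

Lemma maxsub_regular e s : idem mul e -> in_maxsub mul (IGrel mul) e s ->
  wf mul s /\ regular s.
Proof.
  intros He (Hs & Hes & v & Hv & _ & Hsv & _). split; trivial. exists v. split; trivial.
  rewrite app_assoc, Hsv. apply cong_local_unit; trivial. now apply word_omega_l.
Qed.

Lemma maxsub_RIG e s : in_maxsub mul (IGrel mul) e s -> in_maxsub mul (RIGrel mul) e s.
Proof.
  intros (Hs & Hes & v & Hv & Hev & Hsv & Hvs).
  split; [|split]; trivial; [now apply IGeq_RIGeq|].
  exists v. repeat split; trivial; try apply Hv; now apply IGeq_RIGeq.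
Qed.

(** [e s] is not known in advance to be regular, so injectivity does not apply; instead a right unit
    [g] of [s] gives [e s = e s g = s]. *)
Lemma regular_RIG_local e s : idem mul e -> wf mul s -> regular s ->
  RIGeq mul s ([e] ++ s ++ [e]) -> e :: s ~ s /\ s ++ [e] ~ s.
Proof.
  intros He Hs Rs E.
  apply cong_local_unit in E; [|now apply IGeq_RIGeq, word_omega_l].
  destruct E as [E1 E2]. symmetry in E1, E2. split.
  - destruct (RIG_absorb_left s _ Hs Rs E1) as (g & H1 & H2).
    now rewrite <- H1 at 1.
  - destruct (RIG_absorb_right s _ Hs Rs E2) as (g & H1 & H2).
    now rewrite <- H1 at 1.
Qed.

Lemma maxsub_surj e r : idem mul e -> in_maxsub mul (RIGrel mul) e r ->
  exists s, in_maxsub mul (IGrel mul) e s /\ RIGeq mul s r.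
Proof.
  intros He (Hr & Her & v & Hv & Hev & Hrv & Hvr).
  destruct (regular_RIG_surj r Hr) as (s & Hs & Rs & Es).
  destruct (regular_RIG_surj v Hv) as (t & Ht & Rt & Et).
  destruct (regular_RIG_local e s) as [H1 H2]; trivial.
  { unfold RIGeq in *. now rewrite Es. }
  destruct (regular_RIG_local e t) as [H3 H4]; trivial.
  { unfold RIGeq in *. now rewrite Et. }
  (* Letting [a b] and [e] act on the idempotent [e] lifts the inverse law from RIG(E) to IG(E). *)
  assert (Hinv : forall a b, e :: a ~ a -> RIGeq mul (a ++ b) [e] -> a ++ b ~ [e]).
  { intros a b Ha Hab. rewrite <- Ha.
    transitivity ([e] ++ [e]); [|now apply word_omega_l].
    apply (RIG_action mul assoc (a ++ b) [e] Hab [e]).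
    - exists e. now apply Lidem_idem.
    - right. exists []. now rewrite app_nil_r; apply word_omega_l. }
  exists s. split; trivial. split; [|split]; trivial.
  - change (s ~ e :: s ++ [e]). now rewrite H2, H1.
  - exists t. repeat split; try apply Ht.
    + change (t ~ e :: t ++ [e]). now rewrite H4, H3.
    + apply Hinv; trivial. unfold RIGeq in *. now rewrite Es, Et.
    + apply Hinv; trivial. unfold RIGeq in *. now rewrite Es, Et.
Qed.
End RegularElements.

Theorem mainTheorem2 (S : Type) (mul : S -> S -> S)
  (assoc : forall a b c, mul a (mul b c) = mul (mul a b) c)
  (Sreg : forall a, exists x, mul (mul a x) a = a) :
  (* phi restricted to regular elements of IG(E) is onto RIG(E) ... *)
  (forall r, wf mul r ->
     exists s, wf mul s /\ @regular_in S mul (IGrel mul) s /\ RIGeq mul s r) /\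
  (* ... and injective *)
  (forall s s', wf mul s -> wf mul s' ->
     @regular_in S mul (IGrel mul) s -> @regular_in S mul (IGrel mul) s' ->
     RIGeq mul s s' -> IGeq mul s s') /\
  (* maximal subgroups: phi maps H_e(IG) bijectively onto H_e(RIG) *)
  (forall e, idem mul e ->
     (forall s, @in_maxsub S mul (IGrel mul) e s -> @in_maxsub S mul (RIGrel mul) e s) /\
     (forall r, @in_maxsub S mul (RIGrel mul) e r ->
        exists s, @in_maxsub S mul (IGrel mul) e s /\ RIGeq mul s r) /\
     (forall s s', @in_maxsub S mul (IGrel mul) e s -> @in_maxsub S mul (IGrel mul) e s' ->
        RIGeq mul s s' -> IGeq mul s s')).
Proof.
  split; [|split; [|intros e He; split; [|split]]].
  - intros r Hr. now apply regular_RIG_surj.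
  - intros s s' Hs Hs' Rs Rs' E. now apply regular_RIG_inj.
  - intros s. apply maxsub_RIG.
  - intros r Hr. now apply maxsub_surj.
  - intros s s' Hs Hs' E.
    apply maxsub_regular in Hs, Hs'; trivial. now apply regular_RIG_inj.
Qed.
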